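(* $\Phi_4(3)=\dfrac{13}{24}$ and $\Phi_4(6)=\dfrac58$.
   Context: An infinite binary image is a map $I:\mathbb{Z}^2\to\{\text{black},\text{white}\}$. Two pixels $x,y$ are $4$-adjacent if $|x_1-y_1|+|x_2-y_2|=1$; a white $4$-connected component is a maximal set of white pixels connected under $4$-adjacency, and its size is its number of pixels. $\rho(I)=\liminf_{j\to\infty,\ j\text{ odd}}W_j/j^2$ with $W_j$ the number of white pixels in the $j\times j$ box centered at the origin. $\Phi_4(k)$ is the supremum of $\rho(I)$ over all infinite binary images all of whose white $4$-connected components have size at most $k$. *)

(* Defs.v *)
From mathcomp Require Import all_boot all_order all_algebra.
From mathcomp Require Import all_classical all_reals all_analysis.

Set Implicit Arguments.
Unset Strict Implicit.
Unset Printing Implicit Defensive.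

Import Order.TTheory GRing.Theory Num.Theory.

Local Open Scope classical_set_scope.
Local Open Scope card_scope.
Local Open Scope ring_scope.

Definition pixel : Type := int * int.

Variant color := Black | White.

Definition binary_image := pixel -> color.

Definition is_white (c : color) : bool := if c is White then true else false.

Definition white_set (I : binary_image) : set pixel := [set x | I x = White].

Definition adj4 : rel (int * int) :=
  fun x y => `|x.1 - y.1| + `|x.2 - y.2| == 1.

Definition connected4 (S : set pixel) : Prop :=
  forall x y, S x -> S y ->
    exists p : seq (int * int),
      [/\ path adj4 x p, last x p = y & forall z, z \in p -> S z].

Definition white_component (I : binary_image) (C : set pixel) : Prop :=
  [/\ C !=set0, C `<=` white_set I, connected4 C &
      forall D : set pixel,
        C `<=` D -> D `<=` white_set I -> connected4 D -> D = C].

(* `C #<= `I_k` says that C is finite with at most k elements, so infinite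
   components are excluded. *)
Definition white_components_le (k : nat) (I : binary_image) : Prop :=
  forall C : set pixel, white_component I C -> C #<= `I_k.

(* For odd j, the index i : 'I_j is shifted to i - (j - 1) / 2, so that the
   pairs of indices run over the j x j box centered at the origin. *)
Definition box_pixel (j : nat) (ij : 'I_j * 'I_j) : pixel :=
  ((ij.1 : nat)%:Z - j./2%:Z, (ij.2 : nat)%:Z - j./2%:Z).

Definition white_count (I : binary_image) (j : nat) : nat :=
  #|[pred ij : 'I_j * 'I_j | is_white (I (box_pixel ij))]|.

Definition density (R : realType) (I : binary_image) (j : nat) : R :=
  (white_count I j)%:R / j%:R ^+ 2.

(* The odd sizes are enumerated as j = 2 n + 1. *)
Definition rho (R : realType) (I : binary_image) : \bar R :=
  limn_einf (fun n : nat => (density R I n.*2.+1)%:E).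

Definition Phi4 (R : realType) (k : nat) : \bar R :=
  ereal_sup [set rho R I | I in [set I | white_components_le k I]].

(* Main.v *)
(* Upper bound.  Each black pixel has four neighbors, so 4 |black| counts the
   black-white adjacencies (the perimeters of the white components) and, twice,
   the black-black ones.  A black-black adjacency has two sides; a side whose two
   pixels are white is flat and is charged to the component of these pixels, any
   other side is waste.  Up to boundary terms of order j this gives
     a * 4 |black| - b |white|
       = sum over components C of (a (perimeter C + flat C) - b |C|) + a |waste|,
   with (a, b) = (13, 44) for size 3 and (5, 12) for size 6.  The only components
   with a negative term, namely -2, are the L-tromino for size 3 and the plus
   with one concave corner filled for size 6.  Both have a corner: a white pixel x with
   x + e, x + s white and x - e, x - s, x + e - s, x + s - e black.  Each corner
   receives 2, either from waste sides or from the pixel x - e - s, typically a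
   singleton, which has 8 to share among at most four corners.  That no component
   ends up with a negative balance is a finite computation over the polyominoes
   of the given size; the balance of a component is then spread evenly over its
   pixels, so that box sums can be compared.

   Lower bound.  Colour (x, y) by the class of x + 5 y modulo 24, resp. 8: the
   white components are four L-trominoes for each singleton, resp. pluses. *)
Require Import Defs.
From mathcomp Require Import all_boot all_order all_algebra.
From mathcomp Require Import all_classical all_reals all_analysis.
From mathcomp Require Import zify lra ring.
Set Implicit Arguments.
Unset Strict Implicit.
Unset Printing Implicit Defensive.
Import Order.TTheory GRing.Theory Num.Theory.
Local Open Scope ring_scope.

Local Notation pix := (int * int)%type.
Local Notation view := (pix -> bool).

(** * Local patterns and their charges *)

Definition tau (x : pix) (v : view) : view := fun d => v (x + d).

Definition pE : pix := (1, 0).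
Definition pW : pix := (-1, 0).
Definition pN : pix := (0, 1).
Definition pS : pix := (0, -1).
Definition dirs : seq pix := [:: pE; pW; pN; pS].

Definition frames : seq (pix * pix) :=
  [:: (pE, pN); (pE, pS); (pW, pN); (pW, pS); (pN, pE); (pN, pW); (pS, pE); (pS, pW)].

Definition exposed (v : view) (e : pix) := v 0 && ~~ v e.

Definition flat (v : view) (q : pix * pix) :=
  let: (e, s) := q in [&& v 0, v e, ~~ v (- s) & ~~ v (e - s)].

Definition corner (v : view) (q : pix * pix) :=
  let: (e, s) := q in
  [&& v 0, v e, v s, ~~ v (- e), ~~ v (- s), ~~ v (e - s)
    & ~~ v (s - e)].

(* The implications only inspect pixels linked to the donor, so that [donor], like
   [exposed], [flat] and [corner], depends on the component of 0 alone. *)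
Definition donor (v : view) (q : pix * pix) :=
  let: (e, s) := q in
  [&& v 0, ~~ v e, ~~ v s,
      v (- s) ==> v (e - s) && v (e - s + e)
    & v (- e) ==> v (s - e) && v (s - e + s)].

Definition waste (v : view) (q : pix * pix) :=
  let: (e, s) := q in [&& ~~ v 0, ~~ v e & ~~ (v s && v (e + s))].

(* All charges are doubled, since [frames] lists each flat side and each corner
   twice. *)
Definition gain (a : nat) (v : view) : nat :=
  a.*2 * count (exposed v) dirs + a * count (flat v) frames
  + (count (corner v) frames).*2.

Definition loss (b : nat) (v : view) : nat :=
  b.*2 * v 0 + (count (donor v) frames).*2.

(** Coordinates run from -5 to 5, which holds every connected set of at most six pixels containing
    0. The range is symmetric, so offsets can be negated. *)
Definition window : seq pix :=
  let r := [:: Negz 4; Negz 3; Negz 2; Negz 1; Negz 0; Posz 0; Posz 1; Posz 2;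
               Posz 3; Posz 4; Posz 5] in
  [seq (i, j) | i <- r, j <- r].

Definition profitable (a b : nat) (C : seq pix) : bool :=
  let v := [in C] in
  all ([in window]) C &&
  (sumn [seq loss b (tau d v) | d <- C] <= sumn [seq gain a (tau d v) | d <- C])%N.

Definition fresh_nbrs (seen : seq pix) (z : pix) : seq pix :=
  [seq y <- [seq z + u | u <- dirs] | y \notin seen].
Arguments fresh_nbrs : simpl never.

(* Decides the colour of the pixels of [todo] in all possible ways: each leaf of the
   recursion is one component containing the initial pixels.  Nested [if]s, and not
   [&&] and [||], because [vm_compute] evaluates the arguments of the latter. *)
Fixpoint explore (k a b fuel : nat) (ins outs todo : seq pix) : bool :=
  if fuel is f.+1 then
    if todo is z :: t then
      if explore k a b f ins (z :: outs) t then
        if (size ins < k)%N then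
          explore k a b f (z :: ins) outs
            (t ++ fresh_nbrs (ins ++ outs ++ todo) z)
        else true
      else false
    else profitable a b ins
  else false.

(** * White components *)

Lemma tau_tau (x y : pix) (v : view) : tau y (tau x v) = tau (x + y) v.
Proof. by apply/funext => d; rewrite /tau addrA. Qed.

Lemma dirsN (u : pix) : u \in dirs -> - u \in dirs.
Proof. by rewrite !inE => /or4P[] /eqP->. Qed.

Lemma adj4P (x y : pix) : adj4 x y = (y - x \in dirs).
Proof.
case: x y => [x1 x2] [y1 y2]; rewrite /adj4 /dirs !inE /= -!pair_eqE /pair_eq /=.
by apply/idP/idP; lia.
Qed.

Lemma adj4D (x u : pix) : adj4 x (x + u) = (u \in dirs).
Proof. by rewrite adj4P addrC addKr. Qed.

Lemma adj4C (x y : pix) : adj4 x y = adj4 y x.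
Proof. by rewrite /adj4 distrC [X in _ + X == _]distrC. Qed.

(** The starting pixel is tested too, so the relation is empty on black pixels and reflexive on
    white ones only. *)
Definition joined (v : view) (x y : pix) : Prop :=
  exists p, [/\ path adj4 x p, last x p = y & all v (x :: p)].

Section Joined.
Variable v : view.

Lemma joined_refl x : v x -> joined v x x.
Proof. by move=> vx; exists [::]; split; rewrite //= vx. Qed.

Lemma joined_white x y : joined v x y -> v x /\ v y.
Proof.
move=> [p [_ <- /allP av]]; split; first by apply: av; rewrite mem_head.
by apply: av; apply: mem_last.
Qed.

Lemma joined_trans y x z : joined v x y -> joined v y z -> joined v x z.
Proof.
move=> [p [pp <- /= /andP[vx ap]]] [q [pq <- /= /andP[_ aq]]]; exists (p ++ q).
by rewrite cat_path pp pq last_cat /= vx all_cat ap aq.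
Qed.

Lemma joined_step x y u : joined v x y -> u \in dirs -> v (y + u) -> joined v x (y + u).
Proof.
move=> xy ud vyu; have [_ vy] := joined_white xy; apply: joined_trans xy _.
by exists [:: y + u]; rewrite /= adj4D ud vy vyu.
Qed.

Lemma joined_sym x y : joined v x y -> joined v y x.
Proof.
move=> [p []]; elim: p x => [|z p IH] x /=.
  by move=> _ <- /andP[vx _]; apply: joined_refl.
move=> /andP[xz pz] lp /and3P[vx vz ap].
apply: joined_trans (IH _ pz lp _) _; first by rewrite /= vz.
by exists [:: x]; rewrite /= adj4C xz vx vz.
Qed.

Lemma joined_ind x (P : pix -> Prop) : P x ->
  (forall y u, joined v x y -> P y -> u \in dirs -> v (y + u) -> P (y + u)) ->
  forall y, joined v x y -> P y.
Proof.
move=> Px IH y [p [+ <-]]; elim/last_ind: p {y} => [//|p z IHp].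
rewrite rcons_path last_rcons -cats1 -cat_cons all_cat => /andP[pp lz] /andP[ap].
rewrite /= andbT => vz.
have -> : z = last x p + (z - last x p) by rewrite addrC subrK.
apply: IH; [by exists p|exact: IHp|by rewrite -adj4P|by rewrite addrC subrK].
Qed.

End Joined.

Lemma joined_tau (v : view) (x d d' : pix) :
  joined (tau x v) d d' <-> joined v (x + d) (x + d').
Proof.
split=> j.
  have [vd _] := joined_white j; move: d' j.
  apply: joined_ind => [|y u j IH ud vyu]; first exact: joined_refl.
  by rewrite addrA; apply: joined_step => //; rewrite -addrA.
suff H y : joined v (x + d) y -> joined (tau x v) d (y - x).
  by move: (H _ j); rewrite [x + d']addrC addrK.
move: y; have [vd _] := joined_white j.
apply: joined_ind => [|y u _ IH ud vyu]; first by rewrite addrC addKr; apply: joined_refl.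
rewrite addrAC; apply: joined_step => //.
have -> : y - x + u = y + u - x by rewrite addrAC.
by rewrite /tau addrC subrK.
Qed.

Definition closed_in (v : view) (C : seq pix) :=
  forall y u, y \in C -> u \in dirs -> v (y + u) -> y + u \in C.

Lemma fresh_nbrs_uniq seen z : uniq (fresh_nbrs seen z).
Proof. by rewrite filter_uniq // map_inj_uniq //; apply: addrI. Qed.

Lemma mem_fresh_nbrs seen z y :
  (y \in fresh_nbrs seen z) = (y \notin seen) && (y \in [seq z + u | u <- dirs]).
Proof. by rewrite mem_filter. Qed.

Lemma explore_sound k a b fuel v ins outs todo :
  (forall s, uniq s -> {in s, forall y, joined v 0 y} -> (size s <= k)%N) ->
  explore k a b fuel ins outs todo -> uniq ins -> uniq todo ->
  {in todo, forall z, z \notin ins} -> {in ins, forall y, joined v 0 y} ->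
  {in outs, forall y, ~~ v y} -> {in todo, forall z, v z -> joined v 0 z} ->
  (forall y u, y \in ins -> u \in dirs -> y + u \in ins ++ outs ++ todo) ->
  exists C, [/\ profitable a b C, uniq C, {subset ins <= C},
                {in C, forall y, joined v 0 y} & closed_in v C].
Proof.
move=> small; elim: fuel ins outs todo => [//|f IH] ins outs [|z t] /=.
  move=> pr ui _ _ ji bo _ cl; exists ins; split=> // y u yi ud vyu.
  have := cl y u yi ud; rewrite cats0 mem_cat => /orP[//|/bo].
  by rewrite vyu.
case: ifP => // ex1 ex2 ui /andP[zt ut] dis ji bo jt cl.
have [vz|nvz] := boolP (v z); last first.
  apply: (IH _ _ _ ex1) => //.
  - by move=> y yt; apply: dis; rewrite inE yt orbT.
  - by move=> y; rewrite inE => /predU1P[->|/bo].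
  - by move=> y yt; apply: jt; rewrite inE yt orbT.
  move=> y u yi ud; have := cl y u yi ud; rewrite !mem_cat !inE.
  by case/or4P => ->; rewrite ?orbT.
have jz : joined v 0 z by apply: jt => //; rewrite mem_head.
have zi : z \notin ins by apply: dis; rewrite mem_head.
have uz : uniq (z :: ins) by rewrite /= zi.
have jzi : {in z :: ins, forall y, joined v 0 y}.
  by move=> y; rewrite inE => /predU1P[->|/ji].
(* [z :: ins] is a set of linked pixels, hence of size at most [k]: the white branch was not cut
   off. *)
move: ex2; rewrite (small _ uz jzi) => ex2.
have [||||C [pC uC sC jC cC]] := IH _ _ _ ex2 uz _ _ jzi bo.
- rewrite cat_uniq ut fresh_nbrs_uniq andbT; apply/hasPn => y.
  rewrite mem_fresh_nbrs => /andP[+ _].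
  by rewrite !mem_cat inE !negb_or => /and3P[_ _ /andP[]].
- move=> y; rewrite mem_cat inE negb_or => /orP[yt|].
    rewrite dis ?inE ?yt ?orbT // andbT.
    by apply: contraNneq zt => <-.
  by rewrite mem_fresh_nbrs !mem_cat inE !negb_or => /andP[/and3P[-> _ /andP[->]]].
- move=> y; rewrite mem_cat => /orP[yt|]; first by apply: jt; rewrite inE yt orbT.
  rewrite mem_fresh_nbrs => /andP[_ /mapP[u ud ->]].
  exact: joined_step.
- move=> y u; rewrite inE => /predU1P[->|yi] ud.
    have [|nin] := boolP (z + u \in ins ++ outs ++ z :: t).
      by rewrite !mem_cat !inE => /or4P[] ->; rewrite ?orbT.
    by rewrite !mem_cat mem_fresh_nbrs nin map_f ?orbT.
  have := cl y u yi ud; rewrite !mem_cat !inE.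
  by case/or4P => ->; rewrite ?orbT.
by exists C; split=> // y yi; apply: sC; rewrite inE yi orbT.
Qed.

Lemma framesP (e s : pix) : (e, s) \in frames -> e \in dirs /\ s \in dirs.
Proof.
by rewrite !inE; do 7?case/orP; move=> /eqP[-> ->].
Qed.

(** * Charges depend on the component of the pixel only *)

Section Locality.
Variables v v' : view.
Hypotheses (v0 : v 0) (v'0 : v' 0).
Hypothesis agree : forall x u, v' x -> u \in dirs -> v (x + u) = v' (x + u).

Lemma agree_dirs u : u \in dirs -> v u = v' u.
Proof. by move=> ud; rewrite -[u]add0r agree. Qed.

Lemma exposed_local u : u \in dirs -> exposed v u = exposed v' u.
Proof. by move=> ud; rewrite /exposed v0 v'0 agree_dirs. Qed.

Lemma flat_local q : q \in frames -> flat v q = flat v' q.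
Proof.
case: q => e s /framesP[ed sd]; rewrite /flat v0 v'0 (agree_dirs ed) (agree_dirs (dirsN sd)) /=.
by have [/agree ->|//] := boolP (v' e); rewrite ?dirsN.
Qed.

Lemma corner_local q : q \in frames -> corner v q = corner v' q.
Proof.
case: q => e s /framesP[ed sd]; rewrite /corner v0 v'0.
rewrite (agree_dirs ed) (agree_dirs sd) (agree_dirs (dirsN ed)) (agree_dirs (dirsN sd)) /=.
have [/agree He|//] := boolP (v' e); have [/agree Hs|//] := boolP (v' s).
by rewrite He ?Hs ?dirsN.
Qed.

Lemma donor_local q : q \in frames -> donor v q = donor v' q.
Proof.
case: q => e s /framesP[ed sd]; rewrite /donor v0 v'0.
rewrite (agree_dirs ed) (agree_dirs sd) (agree_dirs (dirsN ed)) (agree_dirs (dirsN sd)) /=.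
have E x y : x \in dirs -> y \in dirs -> v' (- y) ==> v (x - y) && v (x - y + x) =
    v' (- y) ==> v' (x - y) && v' (x - y + x).
  move=> xd yd; have [vy|//] := boolP (v' (- y)).
  rewrite [x - y]addrC (agree vy xd); have [vz|//] := boolP (v' (- y + x)).
  by rewrite (agree vz xd).
by rewrite !E.
Qed.

(** To be applied with [v'] the indicator of a component: the two views then agree on it and on its
    neighbours, and each pattern reads a pixel only next to one already found white. *)
Lemma gain_local a : gain a v = gain a v'.
Proof.
rewrite /gain (eq_in_count exposed_local) (eq_in_count flat_local).
by rewrite (eq_in_count corner_local).
Qed.

Lemma loss_local b : loss b v = loss b v'.
Proof. by rewrite /loss (eq_in_count donor_local) v0 v'0. Qed.

End Locality.

Definition small_components (k : nat) (v : view) :=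
  forall x s, uniq s -> {in s, forall y, joined v x y} -> (size s <= k)%N.

(** The search, run on the view centred at [x], yields a closed list of linked pixels containing 0,
    thus the whole component. Its verdict concerns the indicator of [C] and carries over to [v] by
    locality. *)
Lemma component_list (k a b fuel : nat) (v : view) (x : pix) :
    explore k a b fuel [:: 0] [::] dirs -> small_components k v -> v x ->
  exists C : seq pix,
    [/\ uniq C, {subset C <= window}, forall d, d \in C <-> joined v x (x + d) &
        (\sum_(d <- C) loss b (tau (x + d)%R v) <=
         \sum_(d <- C) gain a (tau (x + d)%R v))%N].
Proof.
move=> ex small vx; set t := tau x v.
have t0 : t 0 by rewrite /t /tau addr0.
have small' s : uniq s -> {in s, forall y, joined t 0 y} -> (size s <= k)%N.
  move=> us js; rewrite -(size_map (+%R x)); apply: (small x).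
    by rewrite map_inj_uniq //; apply: addrI.
  by move=> _ /mapP[y /js /joined_tau + ->]; rewrite addr0.
have [|||||||C [/andP[/allP Cw pC] uC C0 jC cC]] := explore_sound small' ex.
- by [].
- by [].
- by move=> z; rewrite !inE => /or4P[] /eqP->.
- by move=> y; rewrite inE => /eqP->; apply: joined_refl.
- by [].
- move=> z zd tz; rewrite -[z]add0r.
  by apply: joined_step; rewrite ?add0r //; apply: joined_refl.
- by move=> y u; rewrite inE => /eqP-> ud; rewrite add0r /= inE ud orbT.
exists C; split=> // [d|].
  split=> [/jC /joined_tau|]; first by rewrite addr0.
  rewrite -[X in joined v X]addr0 => /(joined_tau v x 0 d); move: d.
  by apply: joined_ind => [|y u _ yC ud tyu]; [rewrite C0 ?mem_head|apply: cC].
have agree d : d \in C -> forall y u, tau d [in C] y -> u \in dirs ->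
    tau (x + d) v (y + u) = tau d [in C] (y + u).
  move=> dC y u yC ud; rewrite -tau_tau.
  change (t (d + (y + u)) = (d + (y + u) \in C)); rewrite addrA.
  apply/idP/idP => [|/jC /joined_white[] //]; exact: cC.
have w0 d : d \in C -> tau (x + d) v 0 /\ tau d [in C] 0.
  by move=> dC; rewrite -tau_tau /tau addr0; split=> //; have /joined_white[] := jC _ dC.
move: pC; rewrite !sumnE !big_map big_seq_cond [X in (_ <= X)%N]big_seq_cond => pC.
rewrite big_seq_cond [X in (_ <= X)%N]big_seq_cond.
have -> : (\sum_(d <- C | (d \in C) && true) loss b (tau (x + d)%R v) =
          \sum_(d <- C | (d \in C) && true) loss b (tau d [in C]))%N.
  apply: eq_bigr => d /andP[dC _]; have [? ?] := w0 d dC.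
  by apply: loss_local => //; apply: agree.
have -> // : (\sum_(d <- C | (d \in C) && true) gain a (tau (x + d)%R v) =
          \sum_(d <- C | (d \in C) && true) gain a (tau d [in C]))%N.
apply: eq_bigr => d /andP[dC _]; have [? ?] := w0 d dC.
by apply: gain_local => //; apply: agree.
Qed.

(* The waste sides that pay for a corner at [e + s], resp. at [- s]. *)
Definition outer_waste (v : view) (q : pix * pix) :=
  let: (e, s) := q in ~~ v 0 && corner (tau (e + s) v) (e, s).

Definition far_waste (v : view) (q : pix * pix) :=
  let: (e, s) := q in waste v (e, s) && corner (tau (- s) v) (e, - s).

(** If the opposite pixel [- e - s] is black, the sides next to it facing the corner are waste. If
    it is white but no donor, one of its implications fails: a black pair bordering the corner then
    has, on its far side, two pixels that are not both white. *)
Lemma corner_paid (v : view) (e s : pix) : (e, s) \in frames -> corner v (e, s) ->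
  [|| donor (tau (- e - s) v) (e, s), outer_waste (tau (- e - s) v) (e, s),
      far_waste (tau (- s) v) (e, - s) | far_waste (tau (- e) v) (s, - e)].
Proof.
rewrite !inE; do 7?case/orP; move=> /eqP[-> ->]; vm_compute;
repeat match goal with |- context [v ?x] => case: (v x) => // end.
Qed.

(** The two outer corners exclude each other, as each needs white a pixel that the other needs
    black. The two far corners coexist in a 2 by 2 square, whence 1 + 2 * 2 = 5. *)
Lemma waste_pays (v : view) (e s : pix) : (e, s) \in frames ->
  (outer_waste v (e, s) + outer_waste (tau e v) (- e, s)
   + 2 * (far_waste v (e, s) + far_waste (tau e v) (- e, s)) <= 5 * waste v (e, s))%N.
Proof.
rewrite !inE; do 7?case/orP; move=> /eqP[-> ->]; vm_compute;
repeat match goal with |- context [v ?x] => case: (v x) => // end.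
Qed.

(** * Box sums up to boundary terms *)

Section Asymptotics.
Variable R : realFieldType.
Implicit Types (f g h : pix -> R).

Definition box_sum (n : nat) f : R :=
  \sum_(i < n.*2.+1) \sum_(j < n.*2.+1) f (i%:Z - n%:Z, j%:Z - n%:Z).

Definition small_mean f :=
  exists C : R, forall n, `|box_sum n f| <= C * n.*2.+1%:R.

Definition asymp f g := small_mean (fun x => f x - g x).

Definition bounded_pix f := exists M : R, forall x, `|f x| <= M.

Lemma box_sumD n f g : box_sum n (fun x => f x + g x) = box_sum n f + box_sum n g.
Proof.
rewrite /box_sum -big_split; apply: eq_bigr => i _; exact: big_split.
Qed.

Lemma box_sumZ n (c : R) f : box_sum n (fun x => c * f x) = c * box_sum n f.
Proof. by rewrite /box_sum mulr_sumr; apply: eq_bigr => i _; rewrite mulr_sumr. Qed.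

Lemma box_sumB n f g : box_sum n (fun x => f x - g x) = box_sum n f - box_sum n g.
Proof.
rewrite -[- box_sum n g]mulN1r -box_sumZ -box_sumD; congr box_sum.
by apply/funext => x; rewrite mulN1r.
Qed.

Lemma ler_box_sum n f g : (forall x, f x <= g x) -> box_sum n f <= box_sum n g.
Proof. by move=> fg; apply: ler_sum => i _; apply: ler_sum. Qed.

Lemma small_meanD f g :
  small_mean f -> small_mean g -> small_mean (fun x => f x + g x).
Proof.
move=> [C fC] [D gD]; exists (C + D) => n; rewrite box_sumD mulrDl.
by rewrite (le_trans (ler_normD _ _)) // lerD.
Qed.

Lemma small_meanZ (c : R) f : small_mean f -> small_mean (fun x => c * f x).
Proof.
move=> [C fC]; exists (`|c| * C) => n.
by rewrite box_sumZ normrM -mulrA ler_wpM2l.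
Qed.

Lemma asymp_refl f : asymp f f.
Proof.
exists 0 => n; rewrite mul0r /box_sum big1 ?normr0 // => i _.
by rewrite big1 // => j _; rewrite subrr.
Qed.

Lemma asymp_trans g f h : asymp f g -> asymp g h -> asymp f h.
Proof.
move=> fg gh; rewrite /asymp.
rewrite (_ : (fun _ => _) = fun x => (f x - g x) + (g x - h x)); first exact: small_meanD.
by apply/funext => x; rewrite addrA subrK.
Qed.

Lemma asympZ (c : R) f g : asymp f g -> asymp (fun x => c * f x) (fun x => c * g x).
Proof.
move=> fg; rewrite /asymp (_ : (fun _ => _) = fun x => c * (f x - g x)).
  exact: small_meanZ.
by apply/funext => x; rewrite mulrBr.
Qed.

Lemma asymp_sym f g : asymp f g -> asymp g f.
Proof.
move=> fg; rewrite /asymp (_ : (fun _ => _) = fun x => -1 * (f x - g x)).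
  exact: small_meanZ.
by apply/funext => x; rewrite mulN1r opprB.
Qed.

Lemma asympD f f' g g' :
  asymp f f' -> asymp g g' -> asymp (fun x => f x + g x) (fun x => f' x + g' x).
Proof.
move=> ff' gg'; rewrite /asymp.
rewrite (_ : (fun _ => _) = fun x => (f x - f' x) + (g x - g' x)).
  exact: small_meanD.
by apply/funext => x; rewrite opprD addrACA.
Qed.

Lemma asympB f f' g g' :
  asymp f f' -> asymp g g' -> asymp (fun x => f x - g x) (fun x => f' x - g' x).
Proof.
move=> ff' /(asympZ (-1)) gg'; have := asympD ff' gg'; congr asymp;
by apply/funext => x; rewrite mulN1r.
Qed.

Lemma asymp_sum (T : eqType) (r : seq T) (F G : T -> pix -> R) :
  {in r, forall q, asymp (F q) (G q)} ->
  asymp (fun x => \sum_(q <- r) F q x) (fun x => \sum_(q <- r) G q x).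
Proof.
elim: r => [_|q r IH FG].
  rewrite (_ : (fun _ => _) = fun=> 0); last by apply/funext => x; rewrite big_nil.
  rewrite (_ : (fun x => \sum_(q <- [::]) G q x) = fun=> 0); first exact: asymp_refl.
  by apply/funext => x; rewrite big_nil.
have -> : (fun x => \sum_(q <- q :: r) F q x) = fun x => F q x + \sum_(q <- r) F q x.
  by apply/funext => x; rewrite big_cons.
have -> : (fun x => \sum_(q <- q :: r) G q x) = fun x => G q x + \sum_(q <- r) G q x.
  by apply/funext => x; rewrite big_cons.
apply: asympD; first by apply: FG; rewrite mem_head.
by apply: IH => p pr; apply: FG; rewrite inE pr orbT.
Qed.

Lemma telescope_bound n (h : nat -> R) (M : R) : (forall k, `|h k| <= M) ->
  `|\sum_(j < n) (h j.+1 - h j)| <= 2 * M.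
Proof.
move=> hM; rewrite -(big_mkord predT (fun j => h j.+1 - h j)) telescope_sumr //.
by rewrite (le_trans (ler_normB _ _)) // mulr_natl mulr2n lerD.
Qed.

(** Along each line of the box in direction [d] the difference telescopes to two end values, and
    there are [n.*2.+1] such lines. *)
Lemma asymp_shift_unit (d : pix) f : d \in [:: (1, 0); (0, 1)] -> bounded_pix f ->
  asymp (fun x => f (x + d)) f.
Proof.
move=> dE [M fM]; exists (2 * M) => n; rewrite /box_sum.
have S (h : nat -> nat -> R) : (forall i j, `|h i j| <= M) ->
    `|\sum_(i < n.*2.+1) \sum_(j < n.*2.+1) (h i j.+1 - h i j)| <= 2 * M * n.*2.+1%:R.
  move=> hM; rewrite (le_trans (ler_norm_sum _ _ _)) //.
  apply: (@le_trans _ _ (\sum_(i < n.*2.+1) (2 * M))).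
    by apply: ler_sum => i _; apply: telescope_bound.
  by rewrite sumr_const card_ord mulr_natr.
move: dE; rewrite !inE => /orP[] /eqP->.
  rewrite exchange_big /=.
  apply: le_trans (S (fun j i => f (i%:Z - n%:Z, j%:Z - n%:Z)) _) => //.
  rewrite le_eqVlt; apply/orP; left; apply/eqP; congr `|_|.
  do 2!apply: eq_bigr => ? _; congr (f _ - _); apply/eqP.
  by rewrite /= -pair_eqE /pair_eq /=; apply/andP; split; apply/eqP; lia.
apply: le_trans (S (fun i j => f (i%:Z - n%:Z, j%:Z - n%:Z)) _) => //.
rewrite le_eqVlt; apply/orP; left; apply/eqP; congr `|_|.
do 2!apply: eq_bigr => ? _; congr (f _ - _); apply/eqP.
by rewrite /= -pair_eqE /pair_eq /=; apply/andP; split; apply/eqP; lia.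
Qed.

Lemma bounded_shift d f : bounded_pix f -> bounded_pix (fun x => f (x + d)).
Proof. by move=> [M fM]; exists M. Qed.

Lemma asymp_shift (d : pix) f : bounded_pix f -> asymp (fun x => f (x + d)) f.
Proof.
(* The shifts satisfying [P] form a subgroup, so the two unit shifts suffice. *)
pose P (d : pix) := forall f, bounded_pix f -> asymp (fun x => f (x + d)) f.
have P0 : P 0 by move=> g _; under eq_fun do rewrite addr0; exact: asymp_refl.
have PD d1 d2 : P d1 -> P d2 -> P (d1 + d2).
  move=> P1 P2 g bg; apply: asymp_trans (P2 g bg).
  by under eq_fun do rewrite addrA; apply: P1 (bounded_shift d2 bg).
have PN d1 : P d1 -> P (- d1).
  move=> P1 g bg; have := asymp_sym (P1 _ (bounded_shift (- d1) bg)).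
  by under [X in asymp _ X]eq_fun do rewrite addrK.
have U d1 : d1 \in [:: (1, 0); (0, 1)] -> P d1.
  by move=> d1E g; apply: asymp_shift_unit.
have PX (a : int) : P (a, 0).
  elim/int_ind: a => [//|a IH|a IH].
    have -> : ((a.+1%:Z, 0) : pix) = (a%:Z, 0) + (1, 0) by rewrite -addn1 PoszD.
    by apply: PD => //; apply: U.
  have -> : ((- a.+1%:Z, 0) : pix) = (- a%:Z, 0) + - (1, 0).
    by rewrite -addn1 PoszD opprD.
  by apply: PD => //; apply/PN/U.
have PY (a : int) : P (0, a).
  elim/int_ind: a => [//|a IH|a IH].
    have -> : ((0, a.+1%:Z) : pix) = (0, a%:Z) + (0, 1) by rewrite -addn1 PoszD.
    by apply: PD => //; apply: U.
  have -> : ((0, - a.+1%:Z) : pix) = (0, - a%:Z) + - (0, 1).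
    by rewrite -addn1 PoszD opprD.
  by apply: PD => //; apply/PN/U.
case: d => a b; have -> : ((a, b) : pix) = (a, 0) + (0, b).
  by apply/eqP; rewrite /= -pair_eqE /pair_eq /= addr0 add0r !eqxx.
by move: f; apply: PD.
Qed.

Lemma bounded_bool (P : pix -> bool) : bounded_pix (fun x => (P x)%:R).
Proof. by exists 1 => x; case: (P x); rewrite ?normr1 ?normr0. Qed.

Definition mean_ge0 f := exists C : R, forall n, - (C * n.*2.+1%:R) <= box_sum n f.

Lemma mean_ge0_le f g : (forall x, f x <= g x) -> mean_ge0 f -> mean_ge0 g.
Proof.
by move=> fg [C fC]; exists C => n; apply: le_trans (ler_box_sum n fg).
Qed.

Lemma mean_ge0_nonneg f : (forall x, 0 <= f x) -> mean_ge0 f.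
Proof.
move=> f0; exists 0 => n; rewrite mul0r oppr0.
by do 2!apply: sumr_ge0 => ? _.
Qed.

Lemma mean_ge0D f g : mean_ge0 f -> mean_ge0 g -> mean_ge0 (fun x => f x + g x).
Proof.
move=> [C fC] [D gD]; exists (C + D) => n.
by rewrite box_sumD mulrDl opprD lerD.
Qed.

Lemma mean_ge0_asymp f g : asymp f g -> mean_ge0 g -> mean_ge0 f.
Proof.
move=> [C fC] [D gD]; exists (C + D) => n.
have := fC n; have := gD n; rewrite box_sumB ler_norml mulrDl => ? /andP[? _].
lra.
Qed.

End Asymptotics.

Lemma window_uniq : uniq window.
Proof. by vm_compute. Qed.

Lemma windowN : perm_eq window [seq - d | d <- window].
Proof. by vm_compute. Qed.

(** * Discharging *)

Section Averaging.
Variables (R : realFieldType) (v : view) (F : pix -> R).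
Hypothesis F_bounded : bounded_pix F.
Hypothesis F_black : forall x, ~~ v x -> F x = 0.
Hypothesis F_component : forall x, v x -> exists C : seq pix,
  [/\ uniq C, {subset C <= window}, forall d, d \in C <-> joined v x (x + d) &
      0 <= \sum_(d <- C) F (x + d)].

Let linked x y := `[< joined v x y >].
Let weight x := count (fun d => linked x (x + d)) window.

Lemma component_weight x C : uniq C -> {subset C <= window} ->
  (forall d, d \in C <-> joined v x (x + d)) ->
  perm_eq [seq d <- window | linked x (x + d)] C /\ weight x = size C.
Proof.
move=> uC sC jC.
have p : perm_eq [seq d <- window | linked x (x + d)] C.
  apply: uniq_perm => //; first by rewrite filter_uniq // window_uniq.
  move=> d; rewrite mem_filter; apply/andP/idP => [[/asboolP /jC //]|dC].
  by split; [apply/asboolP/jC|apply: sC].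
by split=> //; rewrite -(perm_size p) size_filter.
Qed.

(** Both windows, centred at [x] and at [x + d], contain the whole common component. *)
Lemma weight_linked x d : linked x (x + d) -> weight (x + d) = weight x.
Proof.
move=> /asboolP j; have [vx vd] := joined_white j.
have [C [uC sC jC _]] := F_component vx.
have [C' [uC' sC' jC' _]] := F_component vd.
have [_ ->] := component_weight uC sC jC.
have [_ ->] := component_weight uC' sC' jC'.
rewrite -(size_map (+%R x) C) -(size_map (+%R (x + d)) C').
apply/perm_size/uniq_perm; rewrite ?map_inj_uniq //; try exact: addrI.
move=> y; apply/mapP/mapP => [[c /jC' jc ->]|[c /jC jc ->]].
  exists (d + c); rewrite ?addrA //; apply/jC; rewrite addrA.
  exact: joined_trans jc.
exists (c - d); rewrite ?[c - d]addrC ?addrA ?addrK //; apply/jC'.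
rewrite addrA addrK; exact: joined_trans (joined_sym j) jc.
Qed.

Lemma weight_gt0 x : v x -> (0 < weight x)%N.
Proof.
move=> vx; have [C [uC sC jC _]] := F_component vx.
have [_ ->] := component_weight uC sC jC.
have : 0 \in C by apply/jC; rewrite addr0; apply: joined_refl.
by case: C {uC sC jC}.
Qed.

Lemma spread x :
  F x = \sum_(d <- window) (linked (x - d) x)%:R * (F x / (weight x)%:R).
Proof.
have [vx|nvx] := boolP (v x); last first.
  by rewrite F_black // big1 // => d _; rewrite mul0r mulr0.
(* Negating the offsets turns the pixels [x - d] into [x + d], of which [weight x] are linked to
   [x]. *)
rewrite -mulr_suml (perm_big _ windowN) big_map.
rewrite (_ : \sum_(d <- window) _ = (weight x)%:R).
  by rewrite mulrCA mulfV ?mulr1 // pnatr_eq0 -lt0n weight_gt0.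
rewrite /weight; elim: window => [|d r IH]; first by rewrite big_nil.
rewrite big_cons /= natrD IH opprK; congr ((nat_of_bool _)%:R + _).
by apply/idP/idP => /asboolP /joined_sym j; apply/asboolP.
Qed.

Lemma gathered_ge0 x :
  0 <= \sum_(d <- window) (linked x (x + d))%:R * (F (x + d) / (weight (x + d))%:R).
Proof.
have [vx|nvx] := boolP (v x); last first.
  rewrite big1 // => d _; rewrite (_ : linked _ _ = false) ?mul0r //.
  by apply/asboolP => /joined_white[]; rewrite (negbTE nvx).
have [C [uC sC jC FC]] := F_component vx.
have [p _] := component_weight uC sC jC.
rewrite (_ : \sum_(d <- _) _ = (\sum_(d <- C) F (x + d)) / (weight x)%:R).
  by rewrite divr_ge0.
rewrite -(perm_big _ p) big_filter mulr_suml [RHS]big_mkcond.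
apply: eq_bigr => d _; case: ifP => l; last by rewrite mul0r.
by rewrite mul1r weight_linked.
Qed.

(** Each value is split evenly over its component. A pixel then gathers the average of its
    component, which is nonnegative, and the transfers are finitely many bounded shifts, one per
    offset of [window]. *)
Lemma mean_ge0_components : mean_ge0 F.
Proof.
apply: (mean_ge0_asymp _ (mean_ge0_nonneg gathered_ge0)).
apply: asymp_sym; rewrite [X in asymp _ X](_ : F = fun x =>
  \sum_(d <- window) (linked (x - d) x)%:R * (F x / (weight x)%:R)); last first.
  by apply/funext => x; exact: spread.
apply: asymp_sum => d _.
pose g x := (linked (x - d) x)%:R * (F x / (weight x)%:R).
have -> : (fun x => (linked x (x + d))%:R * (F (x + d) / (weight (x + d))%:R)) =
    fun x => g (x + d).
  by apply/funext => x; rewrite /g addrK.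
apply: asymp_shift; have [M FM] := F_bounded; exists M => x.
apply: le_trans (FM x); rewrite /g; case: (linked _ _); last by rewrite mul0r normr0.
rewrite mul1r normrM normfV normr_nat; case: (weight x) => [|m].
  by rewrite invr0 mulr0.
by rewrite ler_pdivrMr ?ltr0n // ler_peMr // ler1n.
Qed.

End Averaging.

Section Discharging.
Variables (R : realFieldType) (v : view) (a b : nat).

Lemma natr_count (T : Type) (P : pred T) (r : seq T) :
  (count P r)%:R = \sum_(q <- r) (P q)%:R :> R.
Proof. by elim: r => [|q r IH]; rewrite ?big_nil // big_cons /= natrD IH. Qed.

Lemma gain_loss_black (w : view) : ~~ w 0 -> gain a w = 0%N /\ loss b w = 0%N.
Proof. by move=> /negbTE w0; rewrite /gain /loss /= /exposed w0 !muln0. Qed.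

Definition balance (x : pix) : R :=
  (gain a (tau x v))%:R - (loss b (tau x v))%:R.

Lemma balance_bounded : bounded_pix balance.
Proof.
exists (a.*2 * 4 + a * 8 + 16 + (b.*2 + 16))%N%:R => x.
rewrite (le_trans (ler_normB _ _)) // !normr_nat -natrD ler_nat leq_add //.
  rewrite /gain leq_add ?leq_add ?leq_mul ?count_size //.
  by rewrite (@leq_double _ 8) count_size.
rewrite /loss leq_add //; first by case: (tau x v 0); rewrite ?muln1 ?muln0.
by rewrite (@leq_double _ 8) count_size.
Qed.

Lemma balance_mean_ge0 k fuel : explore k a b fuel [:: 0] [::] dirs ->
  small_components k v -> mean_ge0 balance.
Proof.
move=> ex small; apply: (@mean_ge0_components _ v _ balance_bounded).
  move=> x nvx; rewrite /balance.
  have [|-> ->] := @gain_loss_black (tau x v); first by rewrite /tau addr0.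
  by rewrite subrr.
move=> x vx; have [C [uC sC jC lg]] := component_list ex small vx.
exists C; split=> //; rewrite sumrB -!natr_sum subr_ge0 ler_nat.
exact: lg.
Qed.

Lemma asymp_view (P : view -> bool) (d : pix) :
  asymp (fun x => (P (tau (x + d) v))%:R : R) (fun x => (P (tau x v))%:R).
Proof. exact: (asymp_shift d (bounded_bool _ (fun x => P (tau x v)))). Qed.

Definition black_white (w : view) (u : pix) := ~~ w 0 && w u.

Definition flanked (w : view) (q : pix * pix) :=
  let: (e, s) := q in [&& ~~ w 0, ~~ w e, w s & w (e + s)].

(** Each of the four directions weighs 2: a white neighbour counts twice, a black one gives two
    sides, each flanked or waste. *)
Lemma black_degree (w : view) : ((~~ w 0%R) * 8 = (count (black_white w) dirs).*2 +
  count (flanked w) frames + count (waste w) frames)%N.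
Proof.
vm_compute; repeat match goal with |- context [w ?x] => case: (w x) => // end.
Qed.

Lemma asymp_exposed :
  asymp (fun x => (count (black_white (tau x v)) dirs)%:R : R)
        (fun x => (count (exposed (tau x v)) dirs)%:R).
Proof.
have p : perm_eq dirs [seq - u | u <- dirs] by vm_compute.
under eq_fun do rewrite natr_count.
under [X in asymp _ X]eq_fun do rewrite natr_count (perm_big _ p) big_map.
apply: asymp_sum => u _.
rewrite (_ : (fun _ => _) = fun x => (exposed (tau (x + u) v) (- u))%:R).
  exact: (asymp_view (fun w => exposed w (- u))).
by apply/funext => x; rewrite /black_white /exposed /tau !addr0 addrK andbC.
Qed.

(** A flat side seen from its black pixels is [flanked]; the two points of view differ by the shift
    [s]. *)
Lemma asymp_flat :
  asymp (fun x => (count (flanked (tau x v)) frames)%:R : R)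
        (fun x => (count (flat (tau x v)) frames)%:R).
Proof.
under eq_fun do rewrite natr_count.
under [X in asymp _ X]eq_fun do rewrite natr_count.
apply: asymp_sum => -[e s] _.
rewrite (_ : (fun _ => _) = fun x => (flat (tau (x + s) v) (e, s))%:R).
  exact: (asymp_view (fun w => flat w (e, s))).
apply/funext => x; rewrite /flanked /flat /tau !addr0 addrK.
rewrite -!addrA [s + (e - s)]addrC subrK [s + e]addrC.
by case: (v x); case: (v (x + e)); case: (v (x + s)); case: (v (x + (e + s))).
Qed.

Definition surplus (x : pix) : R :=
  a%:R * (count (waste (tau x v)) frames)%:R
  - (count (corner (tau x v)) frames).*2%:R + (count (donor (tau x v)) frames).*2%:R.

(** Corner and donor payments enter [balance] and [surplus] with opposite signs and cancel, leaving
    [black_degree] with its first two terms moved to the white side. *)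
Lemma asymp_balance :
  asymp (fun x => (8 * a)%:R * (~~ v x)%:R - b.*2%:R * (v x)%:R)
        (fun x => balance x + surplus x).
Proof.
rewrite (_ : (fun x => (8 * a)%:R * _ - _) = fun x =>
    a.*2%:R * (count (black_white (tau x v)) dirs)%:R
    + a%:R * (count (flanked (tau x v)) frames)%:R
    + (a%:R * (count (waste (tau x v)) frames)%:R - b.*2%:R * (v x)%:R)); last first.
  apply/funext => x; have := black_degree (tau x v); rewrite /tau addr0 -/(tau x v).
  move=> /(congr1 (fun n => a%:R * n%:R : R)); rewrite -!muln2 !(natrD, natrM) => E.
  lra.
rewrite (_ : (fun x => balance x + _) = fun x =>
    a.*2%:R * (count (exposed (tau x v)) dirs)%:R
    + a%:R * (count (flat (tau x v)) frames)%:R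
    + (a%:R * (count (waste (tau x v)) frames)%:R - b.*2%:R * (v x)%:R)); last first.
  apply/funext => x; rewrite /balance /surplus /gain /loss -!muln2 !(natrD, natrM).
  by rewrite (_ : tau x v 0 = v x); [ring|rewrite /tau addr0].
apply: asympD; last exact: asymp_refl.
by apply: asympD; apply: asympZ; [exact: asymp_exposed|exact: asymp_flat].
Qed.

Let W q x : R := (waste (tau x v) q)%:R.
Let O q x : R := (outer_waste (tau x v) q)%:R.
Let L q x : R := (far_waste (tau x v) q)%:R.
Let D q x : R := (donor (tau x v) q)%:R.
Let fee q x : R := a%:R * W q x - 2 * O q x - 4 * L q x.

Lemma big_frames (f : pix * pix -> pix * pix) (G : pix * pix -> R) :
  perm_eq frames (map f frames) -> \sum_(q <- frames) G (f q) = \sum_(q <- frames) G q.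
Proof. by move=> p; rewrite [RHS](perm_big _ p) big_map. Qed.

Lemma surplus_mean_ge0 : (5 <= a)%N -> mean_ge0 surplus.
Proof.
move=> a5.
(* [lower] charges each corner to its possible payers of [corner_paid], at their own positions. *)
pose lower x := \sum_(q <- frames) (a%:R * W q x + 2 * D q x
  - 2 * D q (x + (- q.1 - q.2)) - 2 * O q (x + (- q.1 - q.2))
  - 2 * L (q.1, - q.2) (x + - q.2) - 2 * L (q.2, - q.1) (x + - q.1)).
apply: (@mean_ge0_le _ lower).
  move=> x; rewrite /lower /surplus -!muln2 !natrM !natr_count.
  rewrite mulr_sumr !mulr_suml -sumrB -big_split /= big_seq [leRHS]big_seq.
  apply: ler_sum => -[e s] qf /=; rewrite -/(W _ x) -/(D _ x).
  have : (corner (tau x v) (e, s))%:R <=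
      D (e, s) (x + (- e - s)) + O (e, s) (x + (- e - s))
      + L (e, - s) (x + - s) + L (s, - e) (x + - e) :> R.
    rewrite /D /O /L -!natrD ler_nat.
    have [/(corner_paid qf)|//] := boolP (corner (tau x v) (e, s)).
    by rewrite !tau_tau => /or4P[] ->; rewrite ?addn1 ?addSn ?addnS.
  by lra.
apply: (@mean_ge0_asymp _ _ (fun x => \sum_(q <- frames) fee q x)).
  (* Undoing the shifts costs boundary terms only and makes the donor terms cancel. *)
  apply: (@asymp_trans _ (fun x => \sum_(q <- frames) (a%:R * W q x + 2 * D q x
    - 2 * D q x - 2 * O q x - 2 * L (q.1, - q.2) x - 2 * L (q.2, - q.1) x))).
    apply: asymp_sum => q _.
    do 4!(apply: asympB; last by apply: asympZ; apply: asymp_view (fun w => _ w _) _).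
    exact: asymp_refl.
  rewrite (_ : (fun x => \sum_(q <- frames) fee q x) =
    (fun x => \sum_(q <- frames) (a%:R * W q x + 2 * D q x - 2 * D q x
       - 2 * O q x - 2 * L (q.1, - q.2) x - 2 * L (q.2, - q.1) x))).
    exact: asymp_refl.
  apply/funext => x; rewrite !sumrB big_split /=.
  (* Both symmetries permute the frames, so the two far terms merge into the coefficient 4 of
     [fee]. *)
  rewrite (@big_frames (fun q => (q.1, - q.2)) (fun q => 2 * L q x)); last by vm_compute.
  rewrite (@big_frames (fun q => (q.2, - q.1)) (fun q => 2 * L q x)); last by vm_compute.
  by rewrite -!mulr_sumr; ring.
(* A waste side is listed twice, once from each of its ends; averaging the two
   fees makes the payments pointwise affordable. *)
apply: (@mean_ge0_asymp _ _ (fun x => \sum_(q <- frames)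
    (2^-1 * fee q x + 2^-1 * fee (- q.1, q.2) (x + q.1)))).
  rewrite (_ : (fun x => \sum_(q <- frames) fee q x) = (fun x => \sum_(q <- frames)
    (2^-1 * fee q x + 2^-1 * fee (- q.1, q.2) x))).
    apply: asymp_sum => q _; apply: asympD; first exact: asymp_refl.
    apply/asympZ/asymp_sym; rewrite /fee.
    do 2!(apply: asympB; last by apply: asympZ; apply: asymp_view (fun w => _ w _) _).
    by apply: asympZ; apply: asymp_view (fun w => _ w _) _.
  apply/funext => x; rewrite [RHS]big_split /= -!mulr_sumr.
  rewrite (@big_frames (fun q => (- q.1, q.2)) (fun q => fee q x)); last by vm_compute.
  by field.
apply: mean_ge0_nonneg => x; rewrite big_seq; apply: sumr_ge0 => -[e s] qf.
rewrite /fee /=.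
have -> : W (- e, s) (x + e) = W (e, s) x.
  rewrite /W /waste /tau !addr0 [x + e + (- e + s)]addrA !addrK -[x + e + s]addrA.
  by case: (v x); case: (v (x + e)) => //=; rewrite andbC.
have := waste_pays (tau x v) qf; rewrite !tau_tau.
rewrite -(ler_nat R) !(natrD, natrM) -/(O _ x) -/(L _ x) -/(O _ (x + e)) -/(L _ (x + e)).
rewrite -/(W _ x) => H.
have : 5 * W (e, s) x <= a%:R * W (e, s) x.
  by rewrite ler_wpM2r // ler_nat.
lra.
Qed.

Lemma colour_mean_ge0 k fuel : explore k a b fuel [:: 0] [::] dirs ->
  (5 <= a)%N -> small_components k v ->
  mean_ge0 (fun x => (8 * a)%:R * (~~ v x)%:R - b.*2%:R * (v x)%:R : R).
Proof.
move=> ex a5 small; apply: mean_ge0_asymp asymp_balance _.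
by apply: mean_ge0D (surplus_mean_ge0 a5); apply: balance_mean_ge0 ex small.
Qed.

End Discharging.

(** * Densities *)

Lemma card_le_seq (T : choiceType) (s : seq T) (A : set T) (n : nat) :
  (forall x, A x -> x \in s) -> (size s <= n)%N -> (A #<= `I_n)%card.
Proof.
case: s => [As _|x0 s As sn].
  by rewrite (_ : A = set0) ?card_le0x //; apply/seteqP; split=> // x /As.
apply: card_le_trans (card_image_le (nth x0 (x0 :: s)) _).
apply: subset_card_le => x /As xs; exists (index x (x0 :: s)); last exact: nth_index.
by apply: leq_trans sn; rewrite index_mem.
Qed.

Lemma card_ge_seq (T : choiceType) (s : seq T) (A : set T) (n : nat) : uniq s ->
  {in s, forall x, A x} -> (A #<= `I_n)%card -> (size s <= n)%N.
Proof.
move=> us sA An; rewrite -card_le_II; apply: card_le_trans An.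
apply: card_le_trans (card_image_le (fun x => index x s) A).
apply: subset_card_le => i /= i_s.
case: s us sA i_s => [//|x0 s] us sA i_s.
exists (nth x0 (x0 :: s) i); first by apply/sA/mem_nth.
exact: index_uniq.
Qed.

Definition white_view (I : binary_image) : view := fun x => is_white (I x).

Lemma white_viewP I x : white_set I x <-> white_view I x.
Proof. by rewrite /white_set /white_view /=; case: (I x); split. Qed.

(** The pixels joined to a white [x] form a white component: a path between two of them stays
    inside, because each of its prefixes is again a white path. *)
Lemma small_white_view k I : white_components_le k I -> small_components k (white_view I).
Proof.
set v := white_view I => Ik x s us js.
have [vx|nvx] := boolP (v x); last first.
  case: s us js => [//|y s] _ /(_ y (mem_head _ _)) /joined_white[].
  by rewrite (negbTE nvx).
apply: (@card_ge_seq _ s [set y | joined v x y]) => //; apply: Ik; split.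
- by exists x; apply: joined_refl.
- by move=> y /joined_white[_ /white_viewP].
- move=> y z xy xz; have [p [pp lp ap]] := joined_trans (joined_sym xy) xz.
  exists p; split=> // t tp; have {}tp : t \in y :: p by rewrite inE tp orbT.
  case/splitPl: tp ap pp lp => p1 p2 lp1.
  rewrite -cat_cons all_cat cat_path => /andP[ap1 _] /andP[pp1 _] _.
  by apply: joined_trans xy _; exists p1.
move=> D CD DI cD; apply/seteqP; split=> // y Dy.
have [|p [pp lp pD]] := cD x y _ Dy; first by apply/CD/joined_refl.
exists p; split=> //=; rewrite vx; apply/allP => z /pD /DI.
exact: (iffLR (white_viewP _ _)).
Qed.

Section Density.
Variable R : realType.

Lemma white_count_box I n :
  (white_count I n.*2.+1)%:R = box_sum n (fun x => (white_view I x)%:R : R).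
Proof.
rewrite /white_count -sum1_card /box_sum natr_sum pair_big /= big_mkcond.
apply: eq_bigr => -[i j] _; rewrite /box_pixel /= uphalf_double /white_view inE /=.
by case: (is_white _).
Qed.

Lemma box_sum_const n (c : R) : box_sum n (fun=> c) = c * n.*2.+1%:R ^+ 2.
Proof.
rewrite /box_sum; under eq_bigr do rewrite sumr_const card_ord.
by rewrite sumr_const card_ord expr2 mulrA !mulr_natr.
Qed.

Lemma le_limn_einf (u w : (\bar R)^nat) :
  (forall n, u n <= w n)%E -> (limn_einf u <= limn_einf w)%E.
Proof.
move=> uw; rewrite !limn_einf_lim; apply: lee_lim; try exact: is_cvg_einfs.
near=> n; apply: le_ereal_inf_tmp => _ [m /= nm <-].
by apply: le_trans (uw m); apply: ereal_inf_lbound; exists m.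
Unshelve. all: by end_near.
Qed.

Lemma limn_einf_harmonic (c C : R) : limn_einf (fun n => (c + C * harmonic n)%:E) = c%:E.
Proof.
apply: (cvg_limn_einf_sup _).1; apply: cvg_EFin; first by near=> n.
have : (c + C * harmonic n @[n --> \oo] --> c + C * 0)%classic.
  by apply: cvgD; [exact: cvg_cst|apply: cvgMr; exact: cvg_harmonic].
by rewrite mulr0 addr0.
Unshelve. all: by end_near.
Qed.

Lemma rho_upper a b k fuel I : explore k a b fuel [:: 0] [::] dirs -> (5 <= a)%N ->
  white_components_le k I -> (rho R I <= ((8 * a)%:R / (8 * a + b.*2)%:R)%:E)%E.
Proof.
move=> ex a5 /small_white_view small.
have [C boxC] := colour_mean_ge0 R ex a5 small.
have ab_gt0 : 0 < (8 * a + b.*2)%:R :> R.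
  by rewrite ltr0n addn_gt0 muln_gt0 /= (leq_trans _ a5).
rewrite -(limn_einf_harmonic _ (`|C| / (8 * a + b.*2)%:R)).
apply: le_limn_einf => n; rewrite lee_fin /density.
set W := (white_count _ _)%:R; set m := n.*2.+1%:R.
have m_gt0 : 0 < m :> R by rewrite ltr0n.
have Wm : (8 * a + b.*2)%:R * W <= (8 * a)%:R * m ^+ 2 + `|C| * m.
  (* Black being the complement of white, the weighted colour is affine in the white indicator, and
     the bound on its mean becomes one on [W]. *)
  have := boxC n; rewrite (_ : (fun x => _) = fun x : pix =>
    (8 * a)%:R + - (8 * a + b.*2)%:R * (white_view I x)%:R); last first.
    apply/funext => x; rewrite natrD; case: (white_view I x) => /=; ring.
  rewrite box_sumD box_sumZ -white_count_box box_sum_const -/W -/m.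
  have : C * m <= `|C| * m by rewrite ler_wpM2r ?ler_norm // ltW.
  lra.
(* [harmonic n] is 1 / (n + 1), and n + 1 is at most the side 2 n + 1. *)
have Cm : `|C| * m <= `|C| * (m ^+ 2 * harmonic n).
  rewrite ler_wpM2l // expr2 -mulrA ler_peMr ?(ltW m_gt0) //.
  by rewrite /harmonic /= ler_pdivlMr ?ltr0n // mul1r ler_nat ltnS -addnn leq_addr.
rewrite ler_pdivrMr ?exprn_gt0 // -(ler_pM2l ab_gt0).
apply: (le_trans Wm).
rewrite [leRHS](_ : _ = (8 * a)%:R * m ^+ 2 + `|C| * (m ^+ 2 * harmonic n)).
  by rewrite lerD2l.
by field; rewrite -natrM -natrD gt_eqF.
Qed.

End Density.

(** * Periodic images *)

Section Periodic.
Variables (m : nat) (T : seq bool).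
Hypothesis m_gt0 : (0 < m)%N.

Definition residue (x : pix) : nat := `|((x.1 + 5 * x.2)%R %% m)%Z|%N.

Definition periodic_image : binary_image :=
  fun x => if nth false T (residue x) then White else Black.

Definition flood (r : nat) (L : seq pix) : seq pix :=
  undup (L ++ [seq y <- [seq d + u | d <- L, u <- dirs]
              | nth false T ((r + residue y) %% m)]).

(** A component of at most [k] pixels is exhausted after [k] rounds; closure is tested rather than
    proved. By periodicity, the residue [r] of the starting pixel is all that matters. *)
Definition flood_closed (k r : nat) : bool :=
  let L := iter k (flood r) [:: 0] in
  [&& 0 \in L, (size L <= k)%N &
      all [in L] [seq y <- [seq d + u | d <- L, u <- dirs]
                 | nth false T ((r + residue y) %% m)]].

Definition white_floods (k : nat) : bool :=
  all (fun r => nth false T r ==> flood_closed k r) (iota 0 m).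

Definition row_weight (w : nat) : bool :=
  all (fun r => sumn [seq nth false T ((r + i) %% m) : nat | i <- iota 0 m] == w)
    (iota 0 m).

Lemma residue_modz (x : pix) : (residue x)%:Z = ((x.1 + 5 * x.2) %% m)%Z.
Proof. by rewrite /residue gez0_abs // modz_ge0 // eqz_nat -lt0n. Qed.

Lemma residueD (x y : pix) : residue (x + y) = ((residue x + residue y) %% m)%N.
Proof.
apply/eqP; rewrite -eqz_nat -modz_nat PoszD !residue_modz modzDml modzDmr.
by apply/eqP; congr (_ %% _)%Z; rewrite /=; ring.
Qed.

Lemma residue_lt (x : pix) : (residue x < m)%N.
Proof. by rewrite -ltz_nat residue_modz ltz_pmod. Qed.

Lemma residue_row (i : nat) : residue (i%:Z, 0) = (i %% m)%N.
Proof.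
by apply/eqP; rewrite -eqz_nat residue_modz /= mulr0 addr0 modz_nat.
Qed.

Lemma periodic_view (x : pix) : white_view periodic_image x = nth false T (residue x).
Proof. by rewrite /white_view /periodic_image; case: nth. Qed.

Lemma periodic_components k : white_floods k -> white_components_le k periodic_image.
Proof.
move=> /allP floods C [[x Cx] CI cC _]; set v := white_view periodic_image.
have vx : v x by apply/white_viewP/CI.
have /floods : residue x \in iota 0 m by rewrite mem_iota residue_lt.
rewrite -periodic_view -/v vx implyTb /flood_closed.
set L := iter _ _ _ => /and3P[L0 Lk /allP closed].
apply: (@card_le_seq _ [seq x + d | d <- L]); last by rewrite size_map.
move=> y Cy; have [p [pp lp pC]] := cC x y Cx Cy.
have : joined v x y.
  exists p; split=> //=; rewrite vx; apply/allP => z /pC /CI.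
  exact: (iffLR (white_viewP _ _)).
apply: (@joined_ind v x (fun t => t \in [seq x + d | d <- L])) =>
  [|z u _ /mapP[d dL ->] ud].
  by rewrite -{1}[x]addr0 map_f.
rewrite -addrA /v periodic_view residueD => Tdu; apply/map_f/closed.
by rewrite mem_filter Tdu andTb allpairs_f.
Qed.

Lemma row_count w (x : pix) N : row_weight w ->
  (w * (N %/ m) <= \sum_(i < N) white_view periodic_image (x + (i%:Z, 0))%R)%N.
Proof.
move=> /allP rows.
have row y : (\sum_(i < m) white_view periodic_image (y + (i%:Z, 0))%R = w)%N.
  have /rows/eqP <- : residue y \in iota 0 m by rewrite mem_iota residue_lt.
  rewrite sumnE big_map (_ : iota 0 m = index_iota 0 m) ?big_mkord; last first.
    by rewrite /index_iota subn0.
  by apply: eq_bigr => i _; rewrite periodic_view residueD residue_row modnDmr.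
have blocks q : forall y,
    (\sum_(i < q * m) white_view periodic_image (y + (i%:Z, 0))%R = w * q)%N.
  elim: q => [|q IH] y; first by rewrite muln0 mul0n big_ord0.
  rewrite mulSn big_split_ord /= row mulnS; congr (_ + _)%N.
  rewrite -(IH (y + (m%:Z, 0))%R); apply: eq_bigr => i _; congr (nat_of_bool (_ _)).
  by rewrite -addrA; congr (_ + _); rewrite PoszD.
move: (N %/ m)%N (N %% m)%N (divn_eq N m) => q r ->.
by rewrite big_split_ord /= blocks leq_addr.
Qed.

Lemma rho_periodic (R : realType) w : row_weight w ->
  ((w%:R / m%:R)%:E <= rho R periodic_image)%E.
Proof.
move=> rows; rewrite -(limn_einf_harmonic _ (- w%:R)).
apply: le_limn_einf => n; rewrite lee_fin /density.
set N := n.*2.+1.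
have W : (w * (N %/ m) * N <= white_count periodic_image N)%N.
  rewrite -(ler_nat R) white_count_box /box_sum exchange_big /= natrM mulr_natr.
  rewrite -[X in _ *+ X](card_ord N) -sumr_const; apply: ler_sum => j _.
  rewrite -natr_sum ler_nat.
  apply: leq_trans (row_count (- n%:Z, j%:Z - n%:Z) N rows) _.
  apply/eq_leq/eq_bigr => i _; congr (nat_of_bool (_ _)).
  by rewrite [LHS]addrC; apply/eqP; rewrite /= -pair_eqE /pair_eq /= add0r !eqxx.
have N0 : 0 < N%:R :> R by rewrite ltr0n.
have m0 : 0 < m%:R :> R by rewrite ltr0n.
rewrite ler_pdivlMr ?exprn_gt0 //.
apply: (@le_trans _ _ (w * (N %/ m) * N)%:R); last by rewrite ler_nat.
rewrite !natrM expr2 mulrA ler_pM2r //.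
(* Ignoring the incomplete block at the end of each row costs at most [w] per row, hence a density
   of at most w / N, which [w * harmonic n] dominates. *)
have Nm : N%:R <= (N %/ m)%:R * m%:R + m%:R :> R.
  by rewrite -natrM -natrD ler_nat {1}(divn_eq N m) leq_add2l ltnW // ltn_pmod.
have Nh : 1 <= N%:R * harmonic n :> R.
  rewrite /harmonic /= ler_pdivlMr ?ltr0n // mul1r ler_nat ltnS.
  by rewrite -addnn leq_addr.
have : w%:R * (N%:R / m%:R) <= w%:R * ((N %/ m)%:R + 1) :> R.
  by rewrite ler_wpM2l // ler_pdivrMr // mulrDl mul1r.
have : w%:R * 1 <= w%:R * (N%:R * harmonic n) :> R by rewrite ler_wpM2l.
lra.
Qed.

End Periodic.

(** Residue 2 is the singleton; the L-trominoes are {5, 6, 11}, {8, 9, 13}, {15, 19, 20} and {17,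
    22, 23}. In [tiling6], residue 0 is the centre of the plus. *)
Definition tiling3 : seq bool :=
  [:: false; false; true; false; false; true; true; false; true; true; false; true;
      false; true; false; true; false; true; false; true; true; false; true; true].

Definition tiling6 : seq bool := [:: true; true; false; true; false; true; false; true].

(** Running out of fuel returns [false], so success also certifies that 30 is enough. *)
Lemma explore3 : explore 3 13 44 30 [:: 0] [::] dirs.
Proof. by vm_compute. Qed.
Lemma explore6 : explore 6 5 12 30 [:: 0] [::] dirs.
Proof. by vm_compute. Qed.

Lemma Phi4E (R : realType) k a b fuel m T w :
    explore k a b fuel [:: 0] [::] dirs -> (5 <= a)%N -> (0 < m)%N ->
    white_floods m T k -> row_weight m T w ->
    (8 * a * m = w * (8 * a + b.*2))%N ->
  Phi4 R k = (w%:R / m%:R)%:E.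
Proof.
move=> ex a5 m0 floods rows weights.
have E : (8 * a)%:R / (8 * a + b.*2)%:R = w%:R / m%:R :> R.
  apply/eqP; rewrite eqr_div ?pnatr_eq0 -?lt0n //; first by rewrite -!natrM weights.
  by rewrite addn_gt0 muln_gt0 /= (leq_trans _ a5).
apply/eqP; rewrite eq_le; apply/andP; split.
  apply: ge_ereal_sup => _ [I Ik <-]; rewrite -E; exact: rho_upper ex a5 Ik.
apply: le_trans (rho_periodic m0 R rows) _; apply: ereal_sup_ubound.
by exists (periodic_image m T) => //; exact: periodic_components floods.
Qed.

Theorem theorem8p1 (R : realType) :
  Phi4 R 3 = (13%:R / 24%:R)%:E /\ Phi4 R 6 = (5%:R / 8%:R)%:E.
Proof.
split.
  apply: (@Phi4E R _ _ _ _ 24 tiling3 13 explore3) => //; by vm_compute.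
apply: (@Phi4E R _ _ _ _ 8 tiling6 5 explore6) => //; by vm_compute.
Qed.
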